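(* Let $G$ and $H$ be nontrivial connected graphs, and let $G\Box H$ be their Cartesian product. $(1)$ If neither $G$ nor $H$ is a tree, then $$\max\{|E(G)||V(H)|,\ |E(H)||V(G)|\}+2\leq mc(G\Box H)\leq |E(G)||V(H)|+(|E(H)|-1)|V(G)|+1.$$ $(2)$ If $G$ is not a tree and $H$ is a tree, then $$|E(H)||V(G)|+2\leq mc(G\Box H)\leq |E(G)||V(H)|+1.$$ $(3)$ If both $G$ and $H$ are trees, then $$|E(G)||E(H)|+1\leq mc(G\Box H)\leq |E(G)||E(H)|+2.$$ Moreover, the lower bounds are sharp: for each of $(1)$, $(2)$, $(3)$ there exist graphs $G$ and $H$ satisfying the hypotheses of that part for which $mc(G\Box H)$ equals the stated lower bound.
   Context: All graphs are simple, finite and undirected; nontrivial means having at least two vertices. Let $F$ be a nontrivial connected graph. An edge-coloring of $F$ is any map from $E(F)$ to a set of colors (adjacent edges may receive the same color). A path is monochromatic if all its edges have the same color. An edge-coloring of $F$ is a monochromatic connection coloring ($MC$-coloring) if any two vertices of $F$ are joined by a monochromatic path. The monochromatic connection number $mc(F)$ is the maximum number of colors used in an $MC$-coloring of $F$; if $F$ is not connected, $mc(F)=0$. The Cartesian product $G\Box H$ has vertex set $V(G)\times V(H)$, and $(g,h)$, $(g',h')$ are adjacent if and only if $g=g'$ and $hh'\in E(H)$, or $h=h'$ and $gg'\in E(G)$. *)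

(* Defs.v *)
From HB Require Import structures.
From mathcomp Require Import all_boot.
From mathcomp Require Import boolp.

Set Implicit Arguments.
Unset Strict Implicit.
Unset Printing Implicit Defensive.

Record sgraph := SGraph {
  vertex :> finType;
  adj : rel vertex;
  adj_sym : symmetric adj;
  adj_irrefl : irreflexive adj
}.

Definition edges (F : sgraph) : {set {set F}} :=
  [set [set x; y] | x in F, y in F & adj x y].

Definition nontrivial (F : sgraph) : bool := 1 < #|F|.

Definition connected (F : sgraph) : bool :=
  [forall x : F, forall y : F, connect (@adj F) x y].

(* [ucycle] also accepts the degenerate closed walks [:: x; y] with x, y
   adjacent; a cycle of a simple graph has at least three vertices. *)
Definition acyclic (F : sgraph) : Prop :=
  forall s : seq F, ucycle (@adj F) s -> size s < 3.

Definition tree (F : sgraph) : Prop := connected F /\ acyclic F.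

(* An edge-coloring is given by a map on all sets of vertices, of which only
   the values on [edges F] are ever used. *)
Definition mono_path (F : sgraph) (C : finType) (c : {set F} -> C)
    (x y : F) : Prop :=
  exists (k : C) (p : seq F),
    [/\ path [rel u v | adj u v && (c [set u; v] == k)] x p,
        last x p = y & uniq (x :: p)].

Definition mc_coloring (F : sgraph) (C : finType) (c : {set F} -> C) : Prop :=
  forall x y : F, x != y -> mono_path c x y.

Definition mc_with (F : sgraph) (k : nat) : Prop :=
  exists (C : finType) (c : {set F} -> C),
    mc_coloring c /\ #|[set c e | e in edges F]| = k.

(* The bound on [k] loses nothing: a coloring uses at most one color per edge. *)
Definition mc (F : sgraph) : nat :=
  if connected F then \max_(k < #|edges F|.+1 | `[< mc_with F k >]) k else 0.

Section CartesianProduct.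
Variables G H : sgraph.

Definition cart_adj : rel (G * H) :=
  [rel p q | (p.1 == q.1) && adj p.2 q.2 || (p.2 == q.2) && adj p.1 q.1].

Lemma cart_adj_sym : symmetric cart_adj.
Proof.
by move=> p q; rewrite /cart_adj /= (eq_sym q.1) (eq_sym q.2) !(adj_sym q.1) !(adj_sym q.2).
Qed.

Lemma cart_adj_irrefl : irreflexive cart_adj.
Proof. by move=> p; rewrite /cart_adj /= !adj_irrefl !andbF. Qed.

Definition cart : sgraph := SGraph cart_adj_sym cart_adj_irrefl.

End CartesianProduct.

(* Main.v *)
Require Import Defs.
From HB Require Import structures.
From mathcomp Require Import all_boot.
From mathcomp Require Import boolp zify.

(* Write m and n for the numbers of edges and vertices of a connected graph F.

   Lower bound, mc F >= m - n + 2: give one color to a spanning tree and a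
   color of its own to every other edge.

   Upper bound, mc F <= m - n + N for every properly N-colorable F: given
   a proper vertex coloring f and a color class with s edges, one can delete
   s - 1 vertices so that f becomes injective on each component of the class.
   Indeed, start from a single edge ab of the class, whose ends have distinct
   colors under f, and add the other edges one at a time, deleting one vertex
   whenever two components merge, so that {a, b} stays the only connected pair.
   In an MC-coloring the at least n - (m - mc F) vertices left after
   doing so for every color are pairwise joined by monochromatic paths, hence
   have distinct colors under f.

   The three parts follow by counting the edges of the product, with N = 2 for
   two trees, N = |G| when only H is a tree, and N = max(|G|, |H|) otherwise.
   The lower bounds are attained for C4 [] C4, C4 [] K2 and K2 [] K2, all
   bipartite, where C4 = K2 [] K2. *)

Set Implicit Arguments.
Unset Strict Implicit.
Unset Printing Implicit Defensive.

(** * Edges as unordered pairs of vertices *)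

Lemma edgesP (F : sgraph) (e : {set F}) :
  reflect (exists x y, adj x y /\ e = [set x; y]) (e \in edges F).
Proof.
apply: (iffP imset2P) => [[x y _]|[x [y [xy ->]]]].
  by rewrite inE => /andP[_ xy] ->; exists x, y.
by exists x y; rewrite ?inE.
Qed.

Lemma set2_eq (T : finType) (p q u v : T) :
  [set p; q] = [set u; v] -> p = u /\ q = v \/ p = v /\ q = u.
Proof.
move=> E.
have := set21 p q; have := set22 p q; rewrite E => /set2P qE /set2P pE.
have := set21 u v; have := set22 u v; rewrite -E => /set2P vE /set2P uE.
by case: pE qE vE uE => pE [] qE [] vE [] uE; intuition congruence.
Qed.

Lemma mem_edges (F : sgraph) (x y : F) : ([set x; y] \in edges F) = adj x y.
Proof.
apply/edgesP/idP => [[u [v [uv E]]]|xy]; last by exists x, y.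
by case: (set2_eq E) => -[-> ->]; rewrite // adj_sym.
Qed.

(** * Vertices wasted by a color class, and the upper bound *)

(* [L] is a union-find structure for the edges in [es], started with [a] and
   [b] already merged: every edge costs at most one vertex, put in [S]. *)
Lemma merge_labels (T : finType) (a b : T) (es : seq {set T}) :
  exists (L : T -> T) (S : {set T}),
    [/\ #|S| <= size es, L a = L b,
        forall u v, [set u; v] \in es -> L u = L v
      & forall x y, x != y -> x \notin S -> y \notin S -> L x = L y ->
          [set x; y] = [set a; b]].
Proof.
elim: es => [|e es [L [S [cS Lab Les inj]]]].
  exists (fun x => if x == b then a else x), set0; split=> //=.
  - by rewrite cards0.
  - by rewrite eqxx; case: ifP.
  move=> x y nxy _ _; case: (eqVneq x b) nxy => [->|xb]; case: (eqVneq y b) => [->|yb].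
  - by rewrite ?eqxx.
  - by move=> _ <-; rewrite setUC.
  - by move=> _ ->.
  - by move=> /eqP nxy /nxy.
case: (pickP [pred p : T * T | e == [set p.1; p.2]]) => [[u v] /= /eqP ->|nope];
    last first.
  exists L, S; split=> //; first exact: leqW.
  move=> u v; rewrite inE => /orP[/eqP E|/Les//].
  by have := nope (u, v); rewrite /= E eqxx.
have [Luv|nLuv] := eqVneq (L u) (L v).
  exists L, S; split=> //; first exact: leqW.
  move=> x y; rewrite inE => /orP[/eqP E|/Les//].
  by case: (set2_eq E) => -[-> ->].
(* The classes of [u] and [v] differ, so one of them avoids [a] and [b]; two vertices of that class
   outside [S] would have to be [a] and [b]. *)
have [w [Lw nLw]] : exists w, (w = u \/ w = v) /\ L a != L w.
  have [Eu|nu] := eqVneq (L a) (L u); last by exists u; split=> //; left.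
  by exists v; split; [right | rewrite Eu].
(* the class of [w] has at most one vertex outside [S] *)
have [S' [cS' sSS' S'w]] : exists S' : {set T},
    [/\ #|S'| <= (size es).+1, S \subset S' &
        forall x, L x = L w -> x \in S'].
  case: (pickP [pred z | (z \notin S) && (L z == L w)]) =>
      [z /= /andP[zS /eqP zw]|none].
    exists (z |: S); split; [by rewrite cardsU1 zS | exact: subsetUr|].
    move=> x xw; apply: contraT; rewrite !inE negb_or => /andP[xz xS].
    have E := inj _ _ xz xS zS (etrans xw (esym zw)).
    have : a \in [set x; z] by rewrite E set21.
    rewrite !inE => /orP[] /eqP Ea; move: nLw; rewrite Ea ?xw ?zw eqxx //.
  exists S; split; [exact: leqW | by [] |].
  by move=> x xw; have := none x; rewrite /= xw eqxx andbT => /negbFE.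
exists (fun x => if L x == L u then L v else L x), S'; split=> //.
- by rewrite Lab.
- move=> x y; rewrite inE => /orP[/eqP E|/Les->//].
  by case: (set2_eq E) => -[-> ->]; rewrite ?eqxx //; case: ifP.
move=> x y nxy xS yS E; apply: inj => //.
- exact: contra (subsetP sSS' _) xS.
- exact: contra (subsetP sSS' _) yS.
(* Outside [S'] no vertex has the label of [w], so equal new labels were already equal under [L]. *)
have xw : L x != L w by apply: contra xS => /eqP/S'w.
have yw : L y != L w by apply: contra yS => /eqP/S'w.
case: Lw xw yw => ->; first by move/negPf=> xu /negPf yu; move: E; rewrite xu yu.
move=> xv yv; move: E xv yv.
case: eqP => [->|_]; case: eqP => [->|_] //; last by move=> ->; rewrite eqxx.
by move=> ->; rewrite eqxx.
Qed.

Lemma connect_label (T : finType) (T' : Type) (e : rel T) (L : T -> T') :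
  (forall u v, e u v -> L u = L v) -> forall x y, connect e x y -> L x = L y.
Proof.
move=> eL x y /connectP[p + ->]; elim: p x => //= z p IH x /andP[/eL-> /IH].
by [].
Qed.

Definition edge_rel (F : sgraph) (E : {set {set F}}) : rel F :=
  fun u v => [set u; v] \in E.

Definition colorable (F : sgraph) (N : nat) : Prop :=
  exists f : F -> 'I_N, forall u v, adj u v -> f u != f v.

(** The ends of one edge [e] of the class form the pair merged at the start, so only the other edges
    cost a vertex, which makes the bound strict. *)
Lemma color_class_waste (F : sgraph) (N : nat) (f : F -> 'I_N)
    (E : {set {set F}}) :
  (forall u v, adj u v -> f u != f v) -> E \subset edges F -> E != set0 ->
  exists S : {set F}, #|S| < #|E| /\
    forall x y, x != y -> x \notin S -> y \notin S ->
      connect (edge_rel E) x y -> f x != f y.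
Proof.
move=> fP sE /set0Pn[e eE].
have /edgesP[a [b [ab Ee]]] := subsetP sE e eE.
have [L [S [cS Lab Les inj]]] := merge_labels a b (enum (E :\ e)).
exists S; split; first by move: cS; rewrite -cardE (cardsD1 e E) eE.
move=> x y nxy xS yS /(connect_label (L := L)) Lxy.
have {}Lxy : L x = L y.
  apply: Lxy => u v uvE; have [E0|ne] := eqVneq [set u; v] e; last first.
    by apply: Les; rewrite mem_enum !inE ne.
  by rewrite Ee in E0; case: (set2_eq E0) => -[-> ->].
apply: fP; rewrite -mem_edges (inj x y) // mem_edges //.
Qed.

Lemma mc_with_le (F : sgraph) (N k : nat) :
  colorable F N -> mc_with F k -> #|F| + k <= #|edges F| + N.
Proof.
move=> [f fP] [C [c [cP <-]]].
pose E (i : C) := [set e in edges F | c e == i].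
pose K := c @: edges F.
have cE : #|edges F| = \sum_(i in K) #|E i|.
  rewrite -sum1_card (partition_big_imset c) /=; apply: eq_bigr => i _.
  by rewrite -sum1_card; apply: eq_bigl => e; rewrite !inE.
have /fin_all_exists[S SP] : forall i, exists S : {set F}, i \in K ->
    #|S| < #|E i| /\ forall x y, x != y -> x \notin S -> y \notin S ->
      connect (edge_rel (E i)) x y -> f x != f y.
  move=> i; have [iK|_] := boolP (i \in K); last by exists set0.
  have [||S SP] := @color_class_waste F N f (E i) fP; last by exists S.
    by apply/subsetP => e; rewrite inE => /andP[].
  by case/imsetP: iK => e eF ->; apply/set0Pn; exists e; rewrite inE eF eqxx.
pose U := \bigcup_(i in K) S i.
(* The strict bound saves one vertex for every color in use. *)
have cU : #|U| + #|K| <= #|edges F|.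
  apply: (@leq_trans (\sum_(i in K) (#|S i| + 1))).
    rewrite big_split /= sum1_card leq_add2r /U.
    elim/big_rec2: _ => [|i m A _ Am]; first by rewrite cards0.
    by rewrite (leq_trans (leq_card_setU _ _)) // leq_add2l.
  by rewrite cE; apply: leq_sum => i /SP[]; rewrite addn1.
have injf : {in ~: U &, injective f}.
  move=> x y; rewrite !inE => xU yU fxy; apply: contraTeq isT => nxy.
  have [i [p [px lp _]]] := cP x y nxy.
  case: p px lp => [_ /= xy|z p px lp]; first by rewrite xy eqxx in nxy.
  (* The path is nonempty, and its first edge shows that the color [i] is in use. *)
  have iK : i \in K.
    case/andP: px => /andP[xz /eqP<-] _; apply: imset_f; by rewrite mem_edges.
  have /SP[_ /(_ x y nxy)] := iK; rewrite fxy eqxx; apply.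
  - by apply: contra xU => xi; apply/bigcupP; exists i.
  - by apply: contra yU => yi; apply/bigcupP; exists i.
  apply/connectP; exists (z :: p) => //; apply: sub_path px => u v /andP[uv cuv].
  by rewrite /edge_rel inE mem_edges uv.
have cN : #|~: U| <= N by rewrite -(card_in_imset injf) -[leqRHS]card_ord max_card.
have := cardsC U; rewrite -/K; lia.
Qed.

(** The last hypothesis lets [#|F|] be moved to the right despite truncated subtraction, so that the
    bound can be checked on each term of the maximum. *)
Lemma mc_le (F : sgraph) (N : nat) :
  connected F -> colorable F N -> #|F| <= #|edges F| + N ->
  #|F| + mc F <= #|edges F| + N.
Proof.
move=> cF colF b; rewrite /mc cF -leq_subRL //.
by apply/bigmax_leqP => k /asboolP H; rewrite leq_subRL // mc_with_le.
Qed.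

(** * Spanning trees and the lower bound *)

(** Otherwise [A] would be closed under adjacency and contain everything connected to [r]. *)
Lemma connected_edge_out (F : sgraph) (A : {set F}) (r y : F) :
  connected F -> r \in A -> y \notin A ->
  exists u v, [/\ u \in A, v \notin A & adj u v].
Proof.
move=> cF rA yA; apply: contrapT => no.
have cl : closed (@adj F) A.
  have half u v : adj u v -> u \in A -> v \in A.
    by move=> uv uA; apply: contraT => vA; case: no; exists u, v.
  by move=> u v uv; apply/idP/idP; apply: half; rewrite // adj_sym.
have ry : connect (@adj F) r y by have /forallP/(_ r)/forallP/(_ y) := cF.
by rewrite -(closed_connect cl ry) rA in yA.
Qed.

(* Growing the tree one pendant edge at a time also yields a proper 2-coloring
   [f] of it. *)
Lemma spanning_tree (F : sgraph) (r : F) : connected F ->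
  exists (T : {set {set F}}) (f : F -> bool),
    [/\ T \subset edges F, #|T| < #|F|,
        forall u v, [set u; v] \in T -> f u != f v
      & forall x, connect (edge_rel T) r x].
Proof.
move=> cF.
(* Both ends of an edge of [T] lie in [A], by the clause for either order of the pair; hence
   coloring the new vertex [v] opposite to [u] does not affect old edges. *)
have grow k : k < #|F| -> exists (A : {set F}) (T : {set {set F}}) (f : F -> bool),
    [/\ r \in A /\ #|A| = k.+1, T \subset edges F, #|T| <= k,
        forall u v, [set u; v] \in T -> u \in A /\ f u != f v
      & forall x, x \in A -> connect (edge_rel T) r x].
  elim: k => [|k IH] kF.
    exists [set r], set0, (fun=> true); split=> //.
    - by rewrite set11 cards1.
    - exact: sub0set.
    - by rewrite cards0.
    - by move=> u v; rewrite in_set0.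
    by move=> x /set1P->; apply: connect0.
  have [A [T [f [[rA cA] TE cT Tf AT]]]] := IH (ltnW kF).
  have [y yA] : exists y, y \notin A.
    apply/existsP; rewrite -negb_forall; apply/negP => /forallP AF.
    have : A = [set: F] by apply/setP => y; rewrite AF inE.
    by move=> AE; rewrite AE cardsT in cA; lia.
  have [u [v [uA vA uv]]] := connected_edge_out cF rA yA.
  have uNv : u != v by apply: contraNneq vA => <-.
  exists (v |: A), ([set u; v] |: T), (fun x => if x == v then ~~ f u else f x).
  have sub : subrel (connect (edge_rel T))
                   (connect (edge_rel ([set u; v] |: T))).
    by apply: connect_sub => p q pq; apply: connect1; rewrite /edge_rel setU1r.
  split.
  - by rewrite setU1r // cardsU1 vA cA.
  - by rewrite subUset sub1set mem_edges uv.
  - by rewrite (leq_trans (leq_card_setU _ _)) // cards1 add1n ltnS.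
  - move=> p q; rewrite inE => /orP[/set1P E|pqT].
      case: (set2_eq E) => -[-> ->]; rewrite in_setU1 eqxx (negPf uNv) ?uA ?orbT.
        by case: (f u).
      by case: (f u).
    have pA : p \in A by case: (Tf p q pqT).
    have qA : q \in A by rewrite setUC in pqT; case: (Tf q p pqT).
    have pv : p == v = false by apply: contraNF vA => /eqP<-.
    have qv : q == v = false by apply: contraNF vA => /eqP<-.
    by rewrite pv qv inE pA orbT; case: (Tf p q pqT).
  move=> x; rewrite inE => /orP[/set1P->|/AT/sub//].
  apply: connect_trans (sub _ _ (AT _ uA)) _.
  by apply: connect1; rewrite /edge_rel setU11.
have F0 : 0 < #|F| by apply/card_gt0P; exists r.
have [|A [T [f [[rA cA] TE cT Tf AT]]]] := grow #|F|.-1; first by lia.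
exists T, f; split=> //; first by lia.
  by move=> u v /Tf[].
move=> x; apply: AT; suff -> : A = [set: F] by [].
by apply/eqP; rewrite eqEcard subsetT cardsT cA; lia.
Qed.

Lemma edge_rel_sym (F : sgraph) (E : {set {set F}}) : symmetric (edge_rel E).
Proof. by move=> u v; rewrite /edge_rel setUC. Qed.

Lemma mc_ge (F : sgraph) :
  nontrivial F -> connected F -> #|edges F| + 2 <= mc F + #|F|.
Proof.
move=> nF cF; have /card_gt0P[r _] : 0 < #|F| by exact: ltnW.
have [T [_ [TE cT _ conT]]] := spanning_tree r cF.
(* A tree edge ensures that the common color [None] is counted. *)
have [e0 e0T] : exists e, e \in T.
  apply/set0Pn; apply: contraTneq nF => T0; rewrite /nontrivial -leqNgt.
  rewrite -(cards1 r) -cardsT subset_leq_card //; apply/subsetP => x _.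
  rewrite inE; apply/eqP/esym; apply: (connect_label (L := id)) (conT x).
  by move=> u v; rewrite /edge_rel T0 in_set0.
pose c (e : {set F}) := if e \in T then None else Some e.
have ck : #|c @: edges F| = #|edges F| - #|T| + 1.
  have -> : c @: edges F = None |: Some @: (edges F :\: T).
    apply/setP => o; rewrite !inE; apply/imsetP/orP => [[e eF ->]|].
      rewrite /c; case: ifPn => [_|eT]; first by left.
      by right; apply: imset_f; rewrite inE eT.
    case=> [/eqP->|/imsetP[e]].
      by exists e0; [exact: (subsetP TE) | rewrite /c e0T].
    by rewrite inE => /andP[eT eF] ->; exists e; rewrite // /c (negPf eT).
  rewrite cardsU1 card_imset; last by move=> ? ? [].
  rewrite cardsD (setIidPr TE) addnC; congr (_ + _).
  by apply/eqP; rewrite eqb1; apply/imsetP => -[].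
have mcw : mc_with F #|c @: edges F|.
  exists (option {set F}), c; split=> // x y _.
  have : connect (edge_rel T) x y.
    have symT := sym_connect_sym (@edge_rel_sym F T).
    by apply: connect_trans (conT y); rewrite symT.
  case/connectP => p xp ->; case/shortenP: xp => q xq uq _.
  exists None, q; split=> //; apply: sub_path xq => u v uv /=.
  by rewrite /c -mem_edges (subsetP TE) // ifT.
have le : #|c @: edges F| < #|edges F|.+1 by rewrite ltnS leq_imset_card.
have : #|c @: edges F| <= mc F.
  by rewrite /mc cF; apply: (bigmax_sup (Ordinal le)) => //; apply/asboolP.
rewrite ck; have := subset_leq_card TE; lia.
Qed.

(** * Edge counts of connected graphs, graphs with a cycle, and trees *)

(** The hypothesis expresses through labelings that [E] connects all vertices. Starting
    [merge_labels] from the trivial pair [r], [r] forbids two distinct vertices outside [S] with the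
    same label, so at most one vertex is left there. *)
Lemma card_vertex_le (F : sgraph) (E : {set {set F}}) :
  (forall L : F -> F, (forall u v, [set u; v] \in E -> L u = L v) ->
     forall x y, L x = L y) ->
  #|F| <= #|E| + 1.
Proof.
move=> EL; have [->|/card_gt0P[r _]] := posnP #|F|; first by [].
have [L [S [cS _ LE inj]]] := merge_labels r r (enum E).
have {LE} Lc := EL L (fun u v uv => LE u v (etrans (mem_enum _ _) uv)).
have : #|~: S| <= 1.
  apply/card_le1_eqP => x y; rewrite !inE => xS yS; apply: contrapT => /eqP.
  rewrite eq_sym => nxy.
  have xyr := set2_eq (inj x y nxy xS yS (Lc x y)).
  by case: xyr nxy => -[-> ->]; rewrite eqxx.
have {}cS : #|S| <= #|E| by rewrite [leqRHS]cardE.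
by have := cardsC S; lia.
Qed.

Lemma connected_label (F : sgraph) (T : Type) (L : F -> T) :
  connected F -> (forall u v, adj u v -> L u = L v) -> forall x y, L x = L y.
Proof.
move=> cF adjL x y; apply: connect_label adjL _ _ _.
by have /forallP/(_ x)/forallP/(_ y) := cF.
Qed.

Lemma connected_card (F : sgraph) : connected F -> #|F| <= #|edges F| + 1.
Proof.
move=> cF; apply: card_vertex_le => L LE; apply: connected_label => // u v.
by rewrite -mem_edges; apply: LE.
Qed.

(** Removing the edge [[set x; y]] of a cycle keeps the graph connected, so one edge is saved in the
    count. *)
Lemma cyclic_card (F : sgraph) :
  connected F -> ~ tree F -> #|F| <= #|edges F|.
Proof.
move=> cF nt; have [s ucs ss] : exists2 s : seq F, ucycle (@adj F) s & 2 < size s.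
  apply: contrapT => no; apply: nt; split=> // s ucs; rewrite ltnNge.
  by apply/negP => ss; apply: no; exists s.
case: s ucs ss => [|x [|y [|z q]]] // /andP[cyc].
rewrite /= in cyc; case/and3P: cyc => xy yz zq.
rewrite /= !inE !negb_or => /and3P[/and3P[xNy xNz xq] /andP[yNz yq] _] _.
have xyE : [set x; y] \in edges F by rewrite mem_edges.
rewrite (cardsD1 [set x; y]) xyE addnC.
apply: card_vertex_le => L LE.
have off u v : u \notin [set x; y] -> adj u v -> L u = L v.
  move=> uxy uv; apply: LE; rewrite !inE mem_edges uv andbT.
  by apply: contra uxy => /eqP<-; rewrite set21.
(* From [z] the cycle returns to [x] by steps that each start outside [[set x; y]], hence avoid the
   removed edge. *)
have Lzx : L z = L x.
  have zxy : z \notin [set x; y] by rewrite !inE negb_or eq_sym xNz eq_sym.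
  elim: q z zxy {xNz yNz yz} zq xq yq => [|t q IH] z zxy /=.
    by rewrite andbT => /(off _ _ zxy).
  case/andP=> zt tq; rewrite !inE !negb_or => /andP[xt xq] /andP[yt yq].
  rewrite (off _ _ zxy zt) IH // !inE negb_or eq_sym xt eq_sym //.
have Lxy : L x = L y.
  rewrite -Lzx; apply: off; last by rewrite adj_sym.
  by rewrite !inE negb_or eq_sym xNz eq_sym.
apply: connected_label => // u v uv.
have [E|ne] := eqVneq [set u; v] [set x; y].
  by case: (set2_eq E) => -[-> ->].
by apply: LE; rewrite !inE ne mem_edges.
Qed.

(** An edge outside a spanning tree would close a cycle with the tree path joining its ends, so the
    spanning tree has all edges of [F]. *)
Lemma tree_spec (F : sgraph) :
  nontrivial F -> tree F -> #|edges F| + 1 = #|F| /\ colorable F 2.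
Proof.
move=> nF [cF aF]; have /card_gt0P[r _] : 0 < #|F| by exact: ltnW.
have [T [f [TE cT Tf conT]]] := spanning_tree r cF.
have ET : edges F = T.
  apply/eqP; rewrite eqEsubset TE andbT; apply/subsetP => e /edgesP[u [v [uv ->]]].
  apply: contraT => uvT.
  have : connect (edge_rel T) u v.
    have symT := sym_connect_sym (@edge_rel_sym F T).
    by apply: connect_trans (conT v); rewrite symT.
  case/connectP => p up vE; move: vE; case/shortenP: up => q uq unq _ vE.
  have qadj : path (@adj F) u q.
    by apply: sub_path uq => a b ab; rewrite -mem_edges (subsetP TE).
  have : size (u :: q) < 3.
    apply: aF; rewrite /ucycle unq andbT /= rcons_path qadj -vE.
    by rewrite adj_sym.
  (* The path has length at most one: length zero gives [u = v], length one puts the edge in [T]. *)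
  case: q uq vE {unq qadj} => [|t [|? ?]] //= => [_ vu|].
    by rewrite vu adj_irrefl in uv.
  by rewrite andbT => ut vt; rewrite vt -/(edge_rel T u t) ut in uvT.
split; first by have := connected_card cF; rewrite ET; lia.
exists (fun x => if f x then ord0 else ord_max) => u v.
rewrite -mem_edges ET => /Tf.
by case: (f u); case: (f v).
Qed.

(** * Colorings, connectedness and edge count of Cartesian products *)

Lemma colorableS (F : sgraph) (M N : nat) :
  M <= N -> colorable F M -> colorable F N.
Proof.
move=> MN [f fP]; exists (fun x => widen_ord MN (f x)) => u v /fP.
by apply: contra => /eqP[/val_inj->].
Qed.

Lemma colorable_card (F : sgraph) : colorable F #|F|.
Proof.
exists enum_rank => u v; apply: contraTneq => /enum_rank_inj->.
by rewrite adj_irrefl.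
Qed.

(** Add the colors of the two coordinates modulo [N]: along an edge exactly one summand changes. For
    [N = 0] there are no vertices. *)
Lemma colorable_cart (G H : sgraph) (N : nat) :
  colorable G N -> colorable H N -> colorable (cart G H) N.
Proof.
move=> [f fP] [g gP].
case: N => [|N] in f fP g gP *.
  by exists (fun p : G * H => f p.1) => -[x y]; case: (f x).
exists (fun p : G * H => inord ((f p.1 + g p.2) %% N.+1)) => -[x y] [x' y'] /=.
move=> adjp; apply/eqP => /(congr1 val) /=; rewrite !inordK ?ltn_pmod // => /eqP.
case/orP: adjp => /andP[/eqP /= -> a]; rewrite ?eqn_modDl ?eqn_modDr.
  by rewrite !modn_small // => /eqP/val_inj/eqP; apply/negP; apply: gP.
by rewrite !modn_small // => /eqP/val_inj/eqP; apply/negP; apply: fP.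
Qed.

Lemma connect_homo (T T' : finType) (e : rel T) (e' : rel T') (f : T -> T') :
  (forall u v, e u v -> e' (f u) (f v)) ->
  forall x y, connect e x y -> connect e' (f x) (f y).
Proof.
move=> ee' x y /connectP[p + ->]; elim: p x => //= z p IH x /andP[/ee' xz /IH].
exact: connect_trans (connect1 xz).
Qed.

Lemma connected_cart (G H : sgraph) :
  connected G -> connected H -> connected (cart G H).
Proof.
move=> cG cH; apply/forallP => -[g h]; apply/forallP => -[g' h'].
apply: (@connect_trans _ _ (g', h)).
  have /forallP/(_ g)/forallP/(_ g') := cG.
  apply: (connect_homo (f := fun g => (g, h))) => u v uv.
  by rewrite /= /cart_adj /= uv eqxx orbT.
have /forallP/(_ h)/forallP/(_ h') := cH.
apply: (connect_homo (f := fun h => (g', h))) => u v uv.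
by rewrite /= /cart_adj /= uv eqxx.
Qed.

Lemma card_cart (G H : sgraph) : #|cart G H| = #|G| * #|H|.
Proof. by rewrite card_prod. Qed.

Lemma nontrivial_cart (G H : sgraph) :
  nontrivial G -> nontrivial H -> nontrivial (cart G H).
Proof. by rewrite /nontrivial card_cart => ? ?; nia. Qed.

Lemma setX_inj (S T : finType) (A A' : {set S}) (B B' : {set T}) :
  A != set0 -> B != set0 -> setX A B = setX A' B' -> A = A' /\ B = B'.
Proof.
move=> /set0Pn[a aA] /set0Pn[b bB] E.
have mem x y : (x \in A) && (y \in B) = (x \in A') && (y \in B').
  by have /setP/(_ (x, y)) := E; rewrite !in_setX.
have := mem a b; rewrite aA bB => /esym/andP[aA' bB'].
split; apply/setP => z; first by have := mem z b; rewrite bB bB' !andbT.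
by have := mem a z; rewrite aA aA'.
Qed.

Lemma edge_neq0 (F : sgraph) (e : {set F}) : e \in edges F -> e != set0.
Proof. by case/edgesP=> x [y [_ ->]]; apply/set0Pn; exists x; rewrite set21. Qed.

Lemma card_edge (F : sgraph) (e : {set F}) : e \in edges F -> #|e| = 2.
Proof.
by case/edgesP=> x [y [xy ->]]; rewrite cards2; case: eqVneq xy => // ->;
  rewrite adj_irrefl.
Qed.

(** Every edge of the product is an edge of one factor times a single vertex of the other. The two
    families are disjoint because the first projection has two elements in [EG] and one in [EH]. *)
Lemma card_edges_cart (G H : sgraph) :
  #|edges (cart G H)| = #|edges G| * #|H| + #|edges H| * #|G|.
Proof.
pose EG := [set setX p.1 [set p.2] | p in setX (edges G) [set: H]].
pose EH := [set setX [set p.2] p.1 | p in setX (edges H) [set: G]].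
have s0 (T : finType) (x : T) : [set x] != set0.
  by apply/set0Pn; exists x; rewrite set11.
have -> : edges (cart G H) = EG :|: EH.
  apply/setP => e; rewrite in_setU; apply/edgesP/orP.
    move=> [[g h] [[g' h'] [/= a ->]]].
    case/orP: a => /andP[/eqP /= <- a]; [right | left]; apply/imsetP.
      exists ([set h; h'], g); first by rewrite in_setX mem_edges a inE.
      apply/setP => -[x y]; rewrite !inE /= !xpair_eqE.
      by case: (x == g); rewrite ?andbF.
    exists ([set g; g'], h); first by rewrite in_setX mem_edges a inE.
    apply/setP => -[x y]; rewrite !inE /= !xpair_eqE.
    by case: (y == h); rewrite ?andbF ?andbT.
  case=> /imsetP[[e' z]]; rewrite in_setX => /andP[/edgesP[x [y [xy E]]] _] ->.
    exists (x, z), (y, z); split; first by rewrite /= /cart_adj /= eqxx xy orbT.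
    rewrite /= in E; rewrite E /=; apply/setP => -[u v]; rewrite !inE /= !xpair_eqE.
    by case: (v == z); rewrite ?andbF ?andbT.
  exists (z, x), (z, y); split; first by rewrite /= /cart_adj /= eqxx xy.
  rewrite /= in E; rewrite E /=; apply/setP => -[u v]; rewrite !inE /= !xpair_eqE.
  by case: (u == z); rewrite ?andbF ?andbT.
rewrite cardsU (_ : EG :&: EH = set0) ?cards0 ?subn0; last first.
  apply/setP => e; rewrite in_setI in_set0; apply/andP => -[].
  case/imsetP=> -[a h]; rewrite in_setX => /andP[aE _] ->.
  case/imsetP=> -[b g]; rewrite in_setX => /andP[bE _] /= E.
  have [ag _] := setX_inj (edge_neq0 aE) (s0 _ h) E.
  by have := card_edge aE; rewrite /= ag cards1.
rewrite !card_in_imset ?cardsX ?cardsT // => -[a x] [b y];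
  rewrite !in_setX => /andP[aE _] _ /= E.
  by have [/set1_inj-> ->] := setX_inj (s0 _ x) (edge_neq0 aE) E.
by have [-> /set1_inj->] := setX_inj (edge_neq0 aE) (s0 _ x) E.
Qed.

Lemma mc_cart_ge (G H : sgraph) :
  nontrivial G -> connected G -> nontrivial H -> connected H ->
  #|edges G| * #|H| + #|edges H| * #|G| + 2 <= mc (cart G H) + #|G| * #|H|.
Proof.
move=> nG cG nH cH; rewrite -card_edges_cart -card_cart.
by apply: mc_ge; [exact: nontrivial_cart | exact: connected_cart].
Qed.

Lemma mc_cart_le (G H : sgraph) (N : nat) :
  connected G -> connected H -> colorable G N -> colorable H N -> 1 < N ->
  #|G| * #|H| + mc (cart G H) <= #|edges G| * #|H| + #|edges H| * #|G| + N.
Proof.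
move=> cG cH colG colH N1; rewrite -card_edges_cart -card_cart.
have cc := connected_cart cG cH.
apply: mc_le => //; first exact: colorable_cart.
have := connected_card cc; lia.
Qed.

(** * The single edge and the four-cycle *)

Definition K2 : sgraph.
Proof.
exists bool (fun x y : bool => x != y).
- by move=> x y; rewrite eq_sym.
- by move=> x; rewrite eqxx.
Defined.

Lemma connected_K2 : connected K2.
Proof.
apply/forallP => x; apply/forallP => y.
by have [->|xy] := eqVneq x y; [exact: connect0 | exact: connect1].
Qed.

Lemma nontrivial_K2 : nontrivial K2.
Proof. by rewrite /nontrivial card_bool. Qed.

Lemma tree_K2 : tree K2.
Proof.
split; first exact: connected_K2.
move=> s /andP[_ us]; rewrite ltnS -card_bool -(card_uniqP us); exact: max_card.
Qed.

Lemma square_spec :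
  let C4 := cart K2 K2 in
  [/\ nontrivial C4 /\ connected C4, colorable C4 2,
      #|edges C4| = 4, #|C4| = 4 & ~ tree C4].
Proof.
have [eK colK] := tree_spec nontrivial_K2 tree_K2.
rewrite card_bool addn1 in eK; case: eK => eK.
have nC := nontrivial_cart nontrivial_K2 nontrivial_K2.
have eC : #|edges (cart K2 K2)| = 4 by rewrite card_edges_cart eK card_bool.
have cC : #|cart K2 K2| = 4 by rewrite card_cart card_bool.
split=> //; first by split=> //; apply: connected_cart connected_K2 connected_K2.
  exact: colorable_cart.
by case/(tree_spec nC); rewrite eC cC.
Qed.

(** * Counting for the three parts and the extremal examples *)

Theorem theorem2 :
  (* (1) *)
  (forall G H : sgraph,
     nontrivial G -> connected G -> nontrivial H -> connected H ->
     ~ tree G -> ~ tree H ->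
     maxn (#|edges G| * #|H|) (#|edges H| * #|G|) + 2 <= mc (cart G H)
     /\ mc (cart G H) <= #|edges G| * #|H| + (#|edges H| - 1) * #|G| + 1) /\
  (* (2) *)
  (forall G H : sgraph,
     nontrivial G -> connected G -> nontrivial H -> connected H ->
     ~ tree G -> tree H ->
     #|edges H| * #|G| + 2 <= mc (cart G H)
     /\ mc (cart G H) <= #|edges G| * #|H| + 1) /\
  (* (3) *)
  (forall G H : sgraph,
     nontrivial G -> connected G -> nontrivial H -> connected H ->
     tree G -> tree H ->
     #|edges G| * #|edges H| + 1 <= mc (cart G H)
     /\ mc (cart G H) <= #|edges G| * #|edges H| + 2) /\
  (* sharpness of the lower bounds *)
  (exists G H : sgraph,
     [/\ nontrivial G /\ connected G, nontrivial H /\ connected H,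
         ~ tree G, ~ tree H &
         mc (cart G H) = maxn (#|edges G| * #|H|) (#|edges H| * #|G|) + 2]) /\
  (exists G H : sgraph,
     [/\ nontrivial G /\ connected G, nontrivial H /\ connected H,
         ~ tree G, tree H & mc (cart G H) = #|edges H| * #|G| + 2]) /\
  (exists G H : sgraph,
     [/\ nontrivial G /\ connected G, nontrivial H /\ connected H,
         tree G, tree H & mc (cart G H) = #|edges G| * #|edges H| + 1]).
Proof.
split; [|split; [|split; [|split; [|split]]]].
- move=> G H nG cG nH cH tG tH.
  have eG := cyclic_card cG tG; have eH := cyclic_card cH tH.
  have lo := mc_cart_ge nG cG nH cH.
  have N1 : 1 < maxn #|G| #|H| by rewrite leq_max [1 < _]nG.
  have up := mc_cart_le cG cH (colorableS (leq_maxl _ _) (@colorable_card G))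
               (colorableS (leq_maxr _ _) (@colorable_card H)) N1.
  rewrite /nontrivial in nG nH; split; last first.
    (* If the maximum is [#|H|], this says that [(#|G| - 1) * (#|H| - 1)] is nonnegative; if it is
       [#|G|], it follows from [#|H| >= 2]. *)
    have : maxn #|G| #|H| + #|G| <= #|G| * #|H| + 1.
      by rewrite /maxn; case: ifP => _; nia.
    have : (#|edges H| - 1) * #|G| + #|G| = #|edges H| * #|G|.
      by rewrite mulnBl mul1n subnK // leq_pmull //; lia.
    lia.
  (* Both products in the maximum are at least [#|G| * #|H|], so subtracting this from their sum
     leaves at least the larger one. *)
  by rewrite /maxn; case: ifP => _; nia.
- move=> G H nG cG nH cH tG tH.
  have eG := cyclic_card cG tG; have [eH colH] := tree_spec nH tH.
  have lo := mc_cart_ge nG cG nH cH.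
  have up := mc_cart_le cG cH (@colorable_card G) (colorableS nG colH) nG.
  (* As [#|H| = #|edges H| + 1], the terms [#|edges H| * #|G| + #|G|] of [up] cancel against
     [#|G| * #|H|]. *)
  by rewrite -eH in lo up *; split; nia.
- move=> G H nG cG nH cH tG tH.
  have [eG colG] := tree_spec nG tG; have [eH colH] := tree_spec nH tH.
  have lo := mc_cart_ge nG cG nH cH.
  have up := mc_cart_le cG cH colG colH isT.
  (* For two trees [lo] and [up] both amount to [#|edges G| * #|edges H| + 1]. *)
  by rewrite -eG -eH in lo up *; split; nia.
(* In each example both factors are 2-colorable, and for [N = 2] the upper estimate meets the lower
   one. *)
- have [[nC cC] colC eC vC tC] := square_spec.
  exists (cart K2 K2), (cart K2 K2); split=> //.
  have lo := mc_cart_ge nC cC nC cC; have up := mc_cart_le cC cC colC colC isT.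
  by rewrite eC vC in lo up *; lia.
- have [[nC cC] colC eC vC tC] := square_spec.
  have [[nK cK] tK] := (nontrivial_K2, connected_K2, tree_K2).
  have [eK colK] := tree_spec nK tK; rewrite card_bool in eK.
  exists (cart K2 K2), K2; split=> //.
  have lo := mc_cart_ge nC cC nK cK; have up := mc_cart_le cC cK colC colK isT.
  by rewrite eC vC card_bool in lo up *; lia.
have [[nK cK] tK] := (nontrivial_K2, connected_K2, tree_K2).
have [eK colK] := tree_spec nK tK; rewrite card_bool in eK.
exists K2, K2; split=> //.
have lo := mc_cart_ge nK cK nK cK; have up := mc_cart_le cK cK colK colK isT.
by rewrite card_bool in lo up *; nia.
Qed.
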